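(* Let $(X,G)$ be topologically transitive and $X_0$ a dense $G$-invariant subset of $X_t$. Suppose $\lambda$ is a $G$-invariant Borel probability measure on $X$ with full topological support and $\lambda(X_0)=1$. Then $$Q_0=S^\ast_0=S^{eq}_0=\bigcap_{N\in\mathcal N}K_0(N)=\Big(\bigcap_{N\in\mathcal N}K_t(N)\Big)\cap X_0^2,$$ where $K_0(N),K_t(N)$ are defined using $\lambda$. In particular $S^{eq}_0=S^{eq}_t\cap X_0^2$. These identities hold for every such measure $\lambda$.
   Context: $G$ is a group acting by homeomorphisms $x\mapsto gx$ on a compact metrizable space $X$, topologically transitive; $X_t:=\{x\in X:\overline{Gx}=X\}$ (subspace topology), $G$ acts diagonally on $X^2$. For a dense $G$-invariant $X_0\subseteq X_t$: $\Delta_0:=\{(x,x):x\in X_0\}$; $\mathcal U_0$ = family of sets $U\cap X_0^2$ with $U\subseteq X^2$ open, $G$-invariant, $\Delta_0\subseteq U$; $Q_0:=\bigcap_{U_0\in\mathcal U_0}\overline{U_0}\cap X_0^2$; $S^\ast_0$ = smallest closed (in $X_0^2$) $G$-invariant equivalence relation on $X_0$ containing $Q_0$; $S^{eq}_0:=\bigcap_\pi\{(x,x')\in X_0^2:\pi(x)=\pi(x')\}$, over all continuous $G$-equivariant maps $\pi:X_0\to Y$ into compact metrizable minimal equicontinuous systems $(Y,G)$; $S^{eq}_t$ is the same with $X_0=X_t$. $\mathcal N$ = family of closed $G$-invariant subsets of $X^2$; $N_x:=\{y:(x,y)\in N\}$; $d_N(x,x'):=\lambda(N_x\triangle N_{x'})$;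 $K_0(N):=\{(x,x')\in X_0^2:d_N(x,x')=0\}$, $K_t(N):=\{(x,x')\in X_t^2:d_N(x,x')=0\}$. *)

(* Defs.v *)
From HB Require Import structures.
From mathcomp Require Import all_boot all_order all_algebra.
From mathcomp Require Import monoid.
From mathcomp Require Import all_classical all_reals all_analysis.
Set Implicit Arguments. Unset Strict Implicit. Unset Printing Implicit Defensive.
Import Order.TTheory GRing.Theory Num.Theory.
Local Open Scope classical_set_scope.

(* act is a (left) action of the group G on X by homeomorphisms
   (each act g is continuous, with continuous inverse act g^-1). *)
Definition is_action (G : groupType) (X : topologicalType) (act : G -> X -> X) :=
  [/\ forall x, act 1%g x = x,
      forall g h x, act (g * h)%g x = act g (act h x)
    & forall g, continuous (act g)].

Definition orbit (G : groupType) (X : Type) (act : G -> X -> X) (x : X) : set X :=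
  [set act g x | g in [set: G]].

Definition Ginvariant (G : groupType) (X : Type) (act : G -> X -> X) (A : set X) :=
  forall g, act g @` A = A.

Definition act2 (G : groupType) (X : Type) (act : G -> X -> X) (g : G) (p : X * X)
  : X * X := (act g p.1, act g p.2).

Definition topologically_transitive (G : groupType) (X : topologicalType)
  (act : G -> X -> X) :=
  forall U V : set X, open U -> open V -> U !=set0 -> V !=set0 ->
    exists g, (act g @` U `&` V) !=set0.

Definition Xt (G : groupType) (X : topologicalType) (act : G -> X -> X) : set X :=
  [set x | closure (orbit act x) = [set: X]].

Definition Q0 (G : groupType) (X : topologicalType) (act : G -> X -> X)
  (X0 : set X) : set (X * X) :=
  [set p | (X0 `*` X0) p /\
     forall U : set (X * X), open U -> Ginvariant (act2 act) U ->
       (forall x, X0 x -> U (x, x)) ->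
       closure (U `&` (X0 `*` X0)) p].

Definition closed_in_sq (X : topologicalType) (X0 : set X) (E : set (X * X)) :=
  exists C : set (X * X), closed C /\ E = C `&` (X0 `*` X0).

Definition equiv_on (X : Type) (X0 : set X) (E : set (X * X)) :=
  [/\ E `<=` X0 `*` X0,
      forall x, X0 x -> E (x, x),
      forall x y, E (x, y) -> E (y, x)
    & forall x y z, E (x, y) -> E (y, z) -> E (x, z)].

Definition Sstar0 (G : groupType) (X : topologicalType) (act : G -> X -> X)
  (X0 : set X) : set (X * X) :=
  [set p | (X0 `*` X0) p /\
     forall E : set (X * X), closed_in_sq X0 E -> Ginvariant (act2 act) E ->
       equiv_on X0 E -> Q0 act X0 `<=` E -> E p].

Definition minimal_equicontinuous (R : realType) (G : groupType)
  (Y : pseudoMetricType R) (actY : G -> Y -> Y) :=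
  [/\ hausdorff_space Y, compact [set: Y], is_action actY,
      (forall y, closure (orbit actY y) = [set: Y])
    & forall e : R, (0 < e)%R -> exists2 d : R, (0 < d)%R &
        forall g y y', ball y d y' -> ball (actY g y) e (actY g y')].

Definition Seq0 (R : realType) (G : groupType) (X : topologicalType)
  (act : G -> X -> X) (X0 : set X) : set (X * X) :=
  [set p | (X0 `*` X0) p /\
     forall (Y : pseudoMetricType R) (actY : G -> Y -> Y) (pi : X -> Y),
       minimal_equicontinuous actY ->
       {within X0, continuous pi} ->
       (forall g x, X0 x -> pi (act g x) = actY g (pi x)) ->
       pi p.1 = pi p.2].

Definition section (X : Type) (N : set (X * X)) (x : X) : set X :=
  [set y | N (x, y)].

Definition symdiff (X : Type) (A B : set X) : set X := (A `\` B) `|` (B `\` A).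

Definition borel (X : ptopologicalType) : measurableType _ := g_sigma_algebraType (@open X).

Definition dN (R : realType) (X : ptopologicalType)
  (lam : probability (borel X) R) (N : set (X * X)) (x x' : X) : \bar R :=
  lam (symdiff (section N x) (section N x') : set (borel X)).

(* K(N) restricted to A^2 (A = X0 gives K_0(N), A = X_t gives K_t(N)) *)
Definition K (R : realType) (X : ptopologicalType)
  (lam : probability (borel X) R) (A : set X) (N : set (X * X)) : set (X * X) :=
  [set p | (A `*` A) p /\ dN lam N p.1 p.2 = 0%E].

Definition bigK (R : realType) (G : groupType) (X : ptopologicalType)
  (act : G -> X -> X) (lam : probability (borel X) R) (A : set X) : set (X * X) :=
  [set p | forall N : set (X * X), closed N -> Ginvariant (act2 act) N ->
     K lam A N p].

(* Main.v *)
(* The inclusion [Q0 <= Sstar0] is formal, and [Sstar0 <= Seq0] holds because an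
   equicontinuous factor map sends a [G]-saturated neighbourhood of the diagonal
   to uniformly close pairs.

   For [Seq0 <= bigK], fix a closed invariant [N].  The function
   [x |-> lam N_x] is invariant and upper semicontinuous, hence constant on
   points with dense orbit, and this makes the invariant pseudometric [d_N]
   continuous there.  An orbit is totally bounded for [d_N], since the translates
   of a ball all have the same positive measure.  Its completion is therefore a
   compact minimal isometric factor, whose factor map separates the points
   with [d_N > 0].

   For [bigK <= Q0], let [U] be an open invariant neighbourhood of the diagonal
   of [X0] and [N := closure U].  Some open [W] containing [x'] lies in [N_x'];
   if [d_N(x, x') = 0], the open set [W \ N_x] is null, hence empty, and
   so [(x, x')] belongs to [N]. *)

Require Import Defs.
From HB Require Import structures.
From mathcomp Require Import all_boot all_order all_algebra.
From mathcomp Require Import monoid.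
From mathcomp Require Import all_classical all_reals all_analysis.
From mathcomp Require Import lra.
Import Order.TTheory GRing.Theory Num.Theory.
Import numFieldNormedType.Exports.
Local Open Scope classical_set_scope.
Local Open Scope ring_scope.
Set Implicit Arguments. Unset Strict Implicit. Unset Printing Implicit Defensive.

(** * Actions by homeomorphisms and invariant sets *)

Section Action.
Variables (G : groupType) (X : topologicalType) (act : G -> X -> X).
Hypothesis actP : is_action act.

Lemma actK (g : G) : cancel (act g) (act g^-1%g).
Proof. by case: actP => a1 aM _ x; rewrite -aM mulVg a1. Qed.

Lemma actVK (g : G) : cancel (act g^-1%g) (act g).
Proof. by case: actP => a1 aM _ x; rewrite -aM mulgV a1. Qed.

Lemma GinvariantP (A : set X) :
  Ginvariant act A <-> forall g x, A x -> A (act g x).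
Proof.
split=> [AG g x Ax|AG g]; first by rewrite -(AG g); exists x.
apply/seteqP; split=> [_ [x Ax <-]|x Ax]; first exact: AG.
by exists (act g^-1%g x); [exact: AG|rewrite actVK].
Qed.

Lemma Ginvariant_act (A : set X) g x : Ginvariant act A -> A (act g x) <-> A x.
Proof.
by move/GinvariantP=> AG; split=> [/(AG g^-1%g)|/AG//]; rewrite actK.
Qed.

Lemma orbit_act g x : Defs.orbit act (act g x) = Defs.orbit act x.
Proof.
case: (actP) => _ aM _; apply/seteqP; split=> _ [h _ <-].
  by exists (h * g)%g => //; rewrite aM.
by exists (h * g^-1)%g => //; rewrite aM actK.
Qed.

Lemma Xt_Ginvariant : Ginvariant act (Xt act).
Proof. by apply/GinvariantP => g x; rewrite /Xt /= orbit_act. Qed.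

Lemma closure_Ginvariant (A : set X) :
  Ginvariant act A -> Ginvariant act (closure A).
Proof.
case: (actP) => _ _ ac /GinvariantP AG; apply/GinvariantP => g x clx B Bgx.
have [y [Ay By]] := clx _ (ac g x B Bgx).
by exists (act g y); split=> //; exact: AG.
Qed.

Lemma orbit_near x (P : set X) (y : X) :
  Xt act x -> nbhs y P -> exists g, P (act g x).
Proof.
move=> xt Py; have : closure (Defs.orbit act x) y by rewrite xt.
by move=> /(_ _ Py)[_ [[g _ <-] Pg]]; exists g.
Qed.

Lemma act2_action : is_action (act2 act).
Proof.
case: (actP) => a1 aM ac; split=> [[x y]|g h [x y]|g [x y]].
- by rewrite /act2 /= !a1.
- by rewrite /act2 /= !aM.
- apply: cvg_pair; apply: continuous_comp (ac g _);
    [exact: cvg_fst|exact: cvg_snd].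
Qed.

End Action.

(** * Topology of the square and Borel sections *)

Lemma near_prod_self (X : topologicalType) (U : set (X * X)) (x : X) :
  nbhs (x, x) U -> exists2 W, open_nbhs x W & W `*` W `<=` U.
Proof.
move=> [[A B] /= [Ax Bx] ABU].
have : nbhs x (A `&` B) by exact: filterI.
rewrite nbhsE => -[W Wx WAB]; exists W => // -[a b] [/= /WAB[Aa _] /WAB[_ Bb]].
by apply: ABU.
Qed.

(** Lets the closures in [Q0], taken of traces on the square of [X0], be replaced by [closure U]. *)
Lemma prod_dense (X : topologicalType) (X0 : set X) (U : set (X * X)) :
  closure X0 = [set: X] -> open U ->
  U `<=` closure (U `&` (X0 `*` X0)).
Proof.
move=> X0d Uo p Up B Bp.
have : nbhs p (U `&` B) by apply: filterI => //; exact: open_nbhs_nbhs.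
case: p {Up Bp} => x y [[P Q] /= [Px Qy] PQ].
have : closure X0 x by rewrite X0d.
move=> /(_ _ Px)[a [X0a Pa]].
have : closure X0 y by rewrite X0d.
move=> /(_ _ Qy)[b [X0b Qb]].
by have [Uab Bab] := PQ (a, b) (conj Pa Qb); exists (a, b).
Qed.

Lemma open_measurable_borel (X : ptopologicalType) (A : set X) :
  open A -> measurable (A : set (borel X)).
Proof. by move=> Ao; exact: sub_sigma_algebra. Qed.

Lemma closed_measurable_borel (X : ptopologicalType) (A : set X) :
  closed A -> measurable (A : set (borel X)).
Proof.
move=> Ac; rewrite -[A]setCK; apply: (@measurableC _ (borel X)).
by apply: open_measurable_borel; exact: closed_openC.
Qed.

Lemma closed_section (X : topologicalType) (N : set (X * X)) x :
  closed N -> closed (section N x).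
Proof.
move=> Nc y cly; apply: Nc => B [[P Q] /= [Px Qy] PQB].
have [z [Nz Qz]] := cly _ Qy; exists (x, z); split=> //; apply: PQB.
by split=> //=; exact: nbhs_singleton.
Qed.

(** * From null section distances to [Q0] *)

Lemma bigK_sub_Q0 (R : realType) (G : groupType) (X : ptopologicalType)
    (act : G -> X -> X) (X0 : set X) (lam : probability (borel X) R) :
  is_action act -> closure X0 = [set: X] ->
  (forall U : set X, open U -> U !=set0 -> (0 < lam (U : set (borel X)))%E) ->
  bigK act lam X0 `<=` Q0 act X0.
Proof.
move=> actP X0d lam_supp [x x'] xKx'; split.
  (* Membership in the square of [X0] is read off from the test set [N = set0]. *)
  by have [] := xKx' _ closed0 (fun g => image_set0 _).
move=> U Uo UG X0U.
have sub : closure U `<=` closure (U `&` (X0 `*` X0)).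
  rewrite [X in _ `<=` X](closure_id _).1; last exact: closed_closure.
  by apply: closure_subset; exact: prod_dense.
apply: sub; set N := closure U.
have Nc : closed N by exact: closed_closure.
have [[_ X0x'] dN0] := xKx' N Nc (closure_Ginvariant (act2_action actP) UG).
have /near_prod_self[W [Wo Wx'] WU] : nbhs (x', x') U.
  by apply: open_nbhs_nbhs; split=> //; exact: X0U.
apply: contrapT => Nxx'.
(* This difference contains [x'] and lies in the symmetric difference of the two sections, since [W]
   is contained in the section over [x']. *)
have Vo : open (W `\` section N x).
  by apply: openI => //; apply: closed_openC; exact: closed_section.
have /lam_supp : (W `\` section N x) !=set0 by exists x'.
move=> /(_ Vo); apply/negP; rewrite -leNgt -dN0; apply: le_measure.
- by rewrite inE; exact: open_measurable_borel.
- have mN z : measurable (section N z : set (borel X)).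
    by apply: closed_measurable_borel; exact: closed_section.
  by rewrite inE; apply: measurableU; apply: (@measurableD _ (borel X)); exact: mN.
- move=> z [Wz Nz]; right; split=> //; apply: subset_closure.
  exact: WU.
Qed.

(** * Equicontinuous factors and the regionally proximal relation *)

(** Equicontinuity yields an open invariant neighbourhood of the diagonal on whose trace in [X0] the
    two images are uniformly close. Pairs of this trace approximate any pair of [Q0]. *)
Lemma Q0_factor (R : realType) (G : groupType) (X : topologicalType)
    (act : G -> X -> X) (X0 : set X) (Y : pseudoMetricType R)
    (actY : G -> Y -> Y) (pi : X -> Y) :
  is_action act -> Ginvariant act X0 -> minimal_equicontinuous actY ->
  {within X0, continuous pi} ->
  (forall g x, X0 x -> pi (act g x) = actY g (pi x)) ->
  forall p, Q0 act X0 p -> pi p.1 = pi p.2.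
Proof.
move=> actP X0G [Yh _ _ _ Yeq] /subspace_continuousP pic piG [x x'].
move=> [[/= X0x X0x'] Qxx']; apply: contrapT => /eqP.
move: Yh; rewrite ball_hausdorff => /[apply].
move=> [[r1 r2] /= /eqP r12].
have pi_near (z : X) (e : R) : 0 < e -> X0 z ->
    exists2 V, open_nbhs z V & forall w, V w -> X0 w -> ball (pi z) e (pi w).
  move=> e0 X0z; have := pic z X0z _ (nbhsx_ballx (pi z) _ e0).
  by rewrite nbhs_simpl /= /within /= nbhsE => -[V Oz OP]; exists V.
(* For an approximating pair [(a, b)], [pi b] is within [2e] of [pi x] and within [e] of [pi x'], so
   it would lie in both separating balls. *)
pose e := Num.min r1%:num r2%:num / 3.
have e0 : 0 < e by rewrite divr_gt0// lt_min !gt0.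
have [d d0 dP] := Yeq _ e0.
have d20 : 0 < d / 2 by rewrite divr_gt0.
(* One translate must carry both points into a common open [V] on whose trace in [X0] the map [pi]
   varies little; allowing any [g] makes [U] invariant. *)
pose U : set (X * X) := [set p | exists g z (V : set X), [/\ X0 z, open V, V z,
  V (act g p.1) /\ V (act g p.2) &
  forall w, V w -> X0 w -> ball (pi z) (d / 2) (pi w)]].
have [_ aM ac] := actP.
have Uo : open U.
  rewrite openE => -[a b] [g [z [V [X0z Oo Oz [Oa Ob] OP]]]].
  exists (act g @^-1` V, act g @^-1` V) => /=.
    by split; apply: ac; exact: open_nbhs_nbhs.
  by move=> [a' b'] [/= Oa' Ob']; exists g, z, V.
have UG : Ginvariant (act2 act) U.
  apply/(GinvariantP (act2_action actP)) => h [a b] [g [z [V [X0z Oo Oz Oab OP]]]].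
  exists (g * h^-1)%g, z, V; split=> //=; move: Oab => /= [Oa Ob].
  by rewrite !aM !actK.
have X0U z : X0 z -> U (z, z).
  move=> X0z; have [V [Oo Oz] OP] := pi_near z _ d20 X0z.
  by exists 1%g, z, V; split=> //=; case: actP => ->.
have Uball a b : U (a, b) -> X0 a -> X0 b -> ball (pi a) e (pi b).
  move=> [g [z [V [X0z Oo Oz [/= Oa Ob] OP]]]] X0a X0b.
  have X0g c : X0 c -> X0 (act g c) by move=> ?; exact/(Ginvariant_act actP _ _ X0G).
  (* The translated images are [d]-close through [pi z]; equicontinuity applied to the inverse of
     [g] brings the estimate back to [a] and [b]. *)
  have: ball (pi (act g a)) d (pi (act g b)).
    by apply: (@ball_splitr _ _ (pi z)); apply: OP => //; exact: X0g.
  move=> /(dP g^-1%g); rewrite -!piG ?actK //; exact: X0g.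
have [V [Oo Ox] OP] := pi_near x _ e0 X0x.
have [V' [V'o V'x'] V'P] := pi_near x' _ e0 X0x'.
have : nbhs (x, x') (V `*` V').
  by exists (V, V') => //=; split; exact: open_nbhs_nbhs.
move=> /(Qxx' U Uo UG X0U)[[a b] [[Uab [/= X0a X0b]] [/= Oa V'b]]].
suff : (ball (pi x) r1%:num `&` ball (pi x') r2%:num) (pi b) by rewrite r12.
have e3 : e * 3 = Num.min r1%:num r2%:num by rewrite /e divfK.
split.
  apply: (@le_ball _ _ _ (e + e)).
    apply: le_trans (_ : e * 3 <= _); last by rewrite e3 ge_min lexx.
    by lra.
  by apply: ball_triangle (OP _ Oa X0a) _; exact: Uball.
apply: (@le_ball _ _ _ e); last exact: V'P.
apply: le_trans (_ : e * 3 <= _); last by rewrite e3 ge_min lexx orbT.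
by lra.
Qed.

(** The kernel of each factor map is one of the relations intersected in [Sstar0]. *)
Lemma Sstar0_sub_Seq0 (R : realType) (G : groupType) (X : topologicalType)
    (act : G -> X -> X) (X0 : set X) :
  is_action act -> Ginvariant act X0 -> Sstar0 act X0 `<=` Seq0 R act X0.
Proof.
move=> actP X0G p [X0p pS]; split=> // Y actY pi Ymin pic piG.
pose E : set (X * X) := [set q | (X0 `*` X0) q /\ pi q.1 = pi q.2].
suff : E p by case.
apply: pS.
(* Since [Y] is Hausdorff and [pi] is continuous on [X0], the closure adds no pair inside the square
   of [X0]. *)
- exists (closure E); split; first exact: closed_closure.
  apply/seteqP; split=> [q Eq|[x x'] [clE [/= X0x X0x']]].
    by split; [exact: subset_closure|case: Eq].
  split=> //=; case: Ymin => Yh _ _ _ _; apply: Yh => A B Ax Bx'.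
  move/subspace_continuousP: pic => pic.
  have := pic x X0x _ Ax; rewrite nbhs_simpl /= /within /= => PA.
  have := pic x' X0x' _ Bx'; rewrite nbhs_simpl /= /within /= => PB.
  have : nbhs (x, x') ([set z | X0 z -> A (pi z)] `*` [set z | X0 z -> B (pi z)]).
    by exists ([set z | X0 z -> A (pi z)], [set z | X0 z -> B (pi z)]).
  move=> /clE[[a b] [[[/= X0a X0b] ab] [/= /(_ X0a) Aa /(_ X0b) Bb]]].
  by exists (pi a); split=> //; rewrite ab.
- apply/(GinvariantP (act2_action actP)) => g [a b] [[/= X0a X0b] ab].
  have X0g c : X0 c -> X0 (act g c) by move=> ?; exact/(Ginvariant_act actP _ _ X0G).
  by split=> /=; [split; exact: X0g|rewrite !piG// ab].
- split=> [q []//|x X0x|x y [[/= ? ?] ?]|x y z [[/= ? ?] xy] [[/= ? ?] yz]] //.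
  by split=> //=; rewrite xy.
- move=> q Qq; split; first by case: Qq.
  exact: (Q0_factor actP X0G Ymin pic piG).
Qed.

(** * Packing in measure and compactness *)

(* Otherwise one could choose arbitrarily many pairwise disjoint sets of
   measure [c] in a probability space. *)
Lemma measure_packing (d : measure_display) (T : measurableType d)
    (R : realType) (P : probability T R) (I : eqType) (A : I -> set T)
    (c : R) :
  0 < c -> (forall i, measurable (A i)) -> (forall i, P (A i) = c%:E) ->
  exists s : seq I, forall i, exists2 j, j \in s & (A j `&` A i) !=set0.
Proof.
move=> c0 mA PA; apply: contrapT => /forallNP nocover.
have next (s : seq I) : exists i, forall j, j \in s -> A j `&` A i = set0.
  have /existsNP[i iP] := nocover s; exists i => j js.
  by apply/eqP/negPn/negP => /set0P ji; apply: iP; exists j.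
have mU (s : seq I) : measurable (\big[setU/set0]_(j <- s) A j).
  by apply: bigsetU_measurable.
(* Greedy choice: each new set is disjoint from the earlier ones and adds [c] to the measure of the
   union, which would pass 1 once [n] exceeds the inverse of [c]. *)
have pack n : exists s : seq I, ((c *+ n)%:E <= P (\big[setU/set0]_(j <- s) A j))%E.
  elim: n => [|n [s IH]]; first by exists [::]; rewrite big_nil measure0.
  have [i iP] := next s; exists (i :: s); rewrite big_cons measureU//.
    by rewrite mulrS EFinD -(PA i); exact: leeD.
  rewrite setIC big_distrl/= big_seq big1// => j js; exact: iP.
have [n nP] : exists n : nat, c^-1 < n%:R.
  by exists (Num.truncn c^-1).+1; exact: truncnS_gt.
have [s] := pack n; apply/negP; rewrite -ltNge.
apply: le_lt_trans (probability_le1 P (mU s)) _.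
by rewrite lte_fin -mulr_natr -ltr_pdivrMl// mulr1.
Qed.

(** An ultrafilter contains one of finitely many balls covering the space, for every radius, and is
    therefore Cauchy. *)
Lemma complete_totally_bounded_compact (R : realType) (T : pseudoMetricType R) :
  (forall F : set_system T, ProperFilter F -> cauchy F -> exists l : T, F --> l) ->
  (forall e : R, 0 < e ->
     exists s : seq T, forall x, exists2 y, y \in s & ball y e x) ->
  compact [set: T].
Proof.
move=> Tc Ttb; rewrite compact_ultra => F FU _.
have [|l Fl] := Tc F _; last by exists l.
apply: cauchy_exP => e e0; have [s sP] := Ttb e e0.
have : F [set x | exists2 y, y \in s & ball y e x].
  by apply: filterS filterT => x _; exact: sP.
(* Balls whose complement is in [F] are discarded one by one; the list cannot run out because [F] is
   proper. *)
elim: s {sP} => [|y s IH] Fs.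
  by have [x [y]] := filter_ex Fs.
have [?|Fy] := in_ultra_setVsetC (ball y e) FU; first by exists y.
apply: IH; apply: filterS (filterI Fs Fy) => x [[z]].
by rewrite inE => /predU1P[->//|zs zx _]; exists z.
Qed.

(** * The compact isometric factor of an invariant pseudometric *)

Section IsometricFactor.
Variables (R : realType) (G : groupType) (X : topologicalType).
Variables (act : G -> X -> X) (d : X -> X -> R) (x0 : X).
Hypothesis actP : is_action act.
Hypothesis d_refl : forall x, d x x = 0.
Hypothesis d_sym : forall x y, d x y = d y x.
Hypothesis d_triangle : forall x y z, d x z <= d x y + d y z.
Hypothesis d_act : forall g x y, d (act g x) (act g y) = d x y.
Hypothesis orbit_totally_bounded : forall e : R, 0 < e ->
  exists s : seq G, forall g,
    exists2 h, h \in s & d (act h x0) (act g x0) < e.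

Let V := arrow_uniform_type X R.

(* Kuratowski embedding: an isometry for the sup distance. *)
Let phi (x : X) : V := d x.

(** The inverse makes this a left action for which [phi] is equivariant. *)
Let translate (g : G) (f : V) : V := fun x => f (act g^-1%g x).

Let ballV (f h : V) e : ball f e h <-> forall x, `|f x - h x| < e.
Proof. by []. Qed.

Let ball_phi x y e : d x y < e -> ball (phi x) e (phi y).
Proof.
move=> xye; apply/ballV => z; apply: le_lt_trans xye.
rewrite ler_norml /phi; apply/andP; split.
  by have := d_triangle y x z; rewrite (d_sym y x); lra.
by have := d_triangle x y z; lra.
Qed.

Let translate_phi g x : translate g (phi x) = phi (act g x).
Proof.
by apply: funext => y; rewrite /translate /phi -(d_act g) actVK.
Qed.

Let ball_translate g f h e :
  ball f e h -> ball (translate g f) e (translate g h).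
Proof. by move=> fh; apply/ballV => x; exact: fh. Qed.

(** The uniform closure of the embedded orbit of [x0], a concrete model of the completion of that
    orbit. *)
Let C : set V := [set f | forall e : R, 0 < e ->
  exists g, ball f e (phi (act g x0))].

Let C_translate g f : C f -> C (translate g f).
Proof.
move=> Cf e e0; have [h fh] := Cf e e0.
exists (g * h)%g; case: (actP) => _ -> _; rewrite -translate_phi.
exact: ball_translate.
Qed.

Let Y : pseudoMetricType R := set_type C.

Let mkY f (Cf : C f) : Y := exist _ f (mem_set Cf).

Let YC (y : Y) : C (val y). Proof. exact: set_mem (valP y). Qed.

Let actY (g : G) (y : Y) : Y := mkY (C_translate g (YC y)).

Let ballY (y z : Y) e : ball y e z <-> ball (val y) e (val z).
Proof. by []. Qed.

(** The domain on which the factor map is meaningful: [phi] sends these points into [C]. *)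
Let D : set X := [set x | forall e : R, 0 < e -> exists g, d x (act g x0) < e].

Let C_phi x : D x -> C (phi x).
Proof. by move=> Dx e e0; have [g /ball_phi] := Dx e e0; exists g. Qed.

Let D_orbit g : D (act g x0).
Proof. by move=> e e0; exists g; rewrite d_refl. Qed.

Let C_closed f : (forall e : R, 0 < e -> exists2 h, C h & ball f e h) -> C f.
Proof.
move=> fC e e0; have e20 : 0 < e / 2 by rewrite divr_gt0.
have [h Ch fh] := fC _ e20; have [g hg] := Ch _ e20.
by exists g; rewrite [e]splitr; exact: ball_triangle fh hg.
Qed.

(** Completeness comes from that of the real-valued functions under uniform convergence, as [C] is
    closed; total boundedness comes from the orbit of [x0], which is dense in [C]. *)
Let Y_compact : compact [set: Y].
Proof.
apply: complete_totally_bounded_compact => [F FF Fc|e e0].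
  have Fc' : cauchy ((val : Y -> V) @ F).
    apply: cauchy_exP => e e0.
    have /(cauchyP F) /(_ e e0)[y Fy] := Fc.
    by exists (val y).
  have /cvg_ex[l Fl] := fun_complete (FF := fmap_proper_filter _ FF) Fc'.
  have Cl : C l.
    apply: C_closed => e e0.
    have Fe : F [set y | ball (l : V) e (val y)] := Fl _ (nbhsx_ballx l _ e0).
    by have [y ly] := filter_ex Fe; exists (val y).
  exists (mkY Cl); apply/fcvg_ballP => e e0.
  exact: Fl _ (nbhsx_ballx l _ e0).
have e20 : 0 < e / 2 by rewrite divr_gt0.
have [s sP] := orbit_totally_bounded e20.
exists [seq mkY (C_phi (D_orbit h)) | h <- s] => y.
have [g yg] := YC y e20; have [h hs hg] := sP g.
exists (mkY (C_phi (D_orbit h))); first exact: map_f.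
apply/ballY; rewrite [e]splitr; apply: ball_triangle (ball_phi hg) _.
exact: ball_sym.
Qed.

Let Y_hausdorff : hausdorff_space Y.
Proof.
rewrite ball_hausdorff => y z yz.
have [x yzx] : exists x, val y x != val z x.
  apply: contrapT => /forallNP yzE; move/eqP: yz; apply; apply: val_inj.
  by apply: funext => x; apply/eqP/negPn/negP/yzE.
(* Half the gap at [x]: a common point of the two balls would make the gap smaller than itself. *)
have r0 : 0 < `|val y x - val z x| / 2.
  by rewrite divr_gt0// normr_gt0 subr_eq0.
exists (PosNum r0, PosNum r0) => /=; apply/eqP/seteqP; split=> // w [].
move=> /ballY /ballV /(_ x) yw /ballY /ballV /(_ x) zw.
have : `|val y x - val z x| < `|val y x - val z x|.
  rewrite {2}[`|_ - _|]splitr.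
  apply: le_lt_trans (ler_distD (val w x) _ _) _.
  by apply: ltrD; rewrite // distrC.
by rewrite ltxx.
Qed.

Let Y_equicontinuous g y z e : ball y e z -> ball (actY g y) e (actY g z).
Proof. by move=> yz; apply/ballY; exact: ball_translate. Qed.

(** If [y] is near the image of [act g x0] and [z] near that of [act h x0], the isometry of
    [h * g^-1] moves [y] near [z]. *)
Let Y_minimal (y : Y) : closure (Defs.orbit actY y) = [set: Y].
Proof.
apply/seteqP; split=> // z _ B; rewrite -nbhs_ballE => -[e /= e0 eB].
have e20 : 0 < e / 2 by rewrite divr_gt0.
have [g yg] := YC y e20; have [h zh] := YC z e20.
exists (actY (h * g^-1)%g y); split; first by exists (h * g^-1)%g.
apply/eB/ballY; rewrite [e]splitr; apply: ball_triangle zh _.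
apply: ball_sym; have := ball_translate (h * g^-1)%g yg.
by rewrite translate_phi; case: (actP) => _ -> _; rewrite actK.
Qed.

Let actYP : is_action actY.
Proof.
case: (actP) => a1 aM _; split=> [y|g h y|g y].
- by apply: val_inj; apply: funext => x /=; rewrite /translate invg1 a1.
- by apply: val_inj; apply: funext => x /=; rewrite /translate invgM aM.
- move=> B /nbhs_ballP[e e0 eB]; apply/nbhs_ballP; exists e => // z yz.
  exact/eB/Y_equicontinuous.
Qed.

Lemma isometric_factor :
  exists (Y : pseudoMetricType R) (actY : G -> Y -> Y) (pi : X -> Y),
    [/\ minimal_equicontinuous actY,
        forall x y e, D x -> D y -> d x y < e -> ball (pi x) e (pi y),
        forall x y, D x -> D y -> pi x = pi y -> d x y = 0
      & forall g x, D x -> pi (act g x) = actY g (pi x)].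
Proof.
(* Outside [D] the value is a default, the image of the base point; the last three conclusions
   concern [D] only. *)
pose pi x : Y := if pselect (D x) is left Dx then mkY (C_phi Dx)
                 else mkY (C_phi (D_orbit 1%g)).
have piE x : D x -> val (pi x) = phi x by rewrite /pi; case: pselect.
exists Y, actY, pi; split=> [|x y e Dx Dy xye|x y Dx Dy pixy|g x Dx].
- split=> //; last by move=> e e0; exists e => // g y z; exact: Y_equicontinuous.
- by apply/ballY; rewrite !piE//; exact: ball_phi.
(* Evaluating the equality of [phi x] and [phi y] at [y] gives [d x y = d y y]. *)
- by have := piE x Dx; rewrite pixy piE// => /(congr1 (@^~ y)); rewrite /phi d_refl.
- have Dgx : D (act g x).
    move=> e /Dx[h xh]; exists (g * h)%g; case: (actP) => _ -> _.
    by rewrite d_act.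
  by apply: val_inj; rewrite /= !piE// translate_phi.
Qed.

End IsometricFactor.

(** * The pseudometric between sections of [N] *)

Section SectionMetric.
Variables (R : realType) (G : groupType) (X : pseudoPMetricType R).
Variables (act : G -> X -> X) (lam : probability (borel X) R).
Variable N : set (X * X).
Hypothesis actP : is_action act.
Hypothesis lam_act : forall g (A : set (borel X)), measurable A ->
  lam (act g @^-1` A : set (borel X)) = lam A.
Hypothesis N_closed : closed N.
Hypothesis N_inv : Ginvariant (act2 act) N.

Let mu (A : set X) : \bar R := lam (A : set (borel X)).

Let mN x : measurable (section N x : set (borel X)).
Proof. by apply: closed_measurable_borel; exact: closed_section. Qed.

Let mND x y : measurable (section N x `\` section N y : set (borel X)).
Proof. exact: (@measurableD _ (borel X)). Qed.

Let msym x y : measurable (symdiff (section N x) (section N y) : set (borel X)).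
Proof. exact: (@measurableU _ (borel X)). Qed.

Lemma section_act g x : section N (act g x) = act g^-1%g @^-1` section N x.
Proof.
apply/seteqP; split=> y; rewrite /section /preimage /=.
  move=> /(Ginvariant_act (act2_action actP) g^-1%g _ N_inv).2.
  by rewrite /act2 /= actK.
move=> /(Ginvariant_act (act2_action actP) g _ N_inv).2.
by rewrite /act2 /= actVK.
Qed.

Lemma dN_act g x y : dN lam N (act g x) (act g y) = dN lam N x y.
Proof. by rewrite /dN !section_act -(lam_act g^-1%g (msym x y)). Qed.

Lemma dN_refl x : dN lam N x x = 0%E.
Proof. by rewrite /dN /symdiff setDv setU0 measure0. Qed.

Lemma dN_sym x y : dN lam N x y = dN lam N y x.
Proof. by rewrite /dN /symdiff setUC. Qed.

Lemma dN_triangle x y z : (dN lam N x z <= dN lam N x y + dN lam N y z)%E.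
Proof.
apply: le_trans (measureU2 _ (msym x y) (msym y z)).
apply: le_measure; rewrite ?inE//; first exact: (@measurableU _ (borel X)).
move=> t; have [Ny|Ny] := pselect (section N y t).
  by move=> [[Nx Nz]|[Nz Nx]]; [right; left|left; right].
by move=> [[Nx Nz]|[Nz Nx]]; [left; left|right; right].
Qed.

Lemma dN_fin_num x y : dN lam N x y \is a fin_num.
Proof. exact: fin_num_measure. Qed.

(* The sets [closure (\bigcup_(y in ball x n.+1^-1) N_y)] decrease to [N_x]. *)
Lemma section_usc x (e : R) : 0 < e ->
  \forall y \near x, (mu (section N y `\` section N x) < e%:E)%E.
Proof.
move=> e0.
pose D n : set X :=
  closure [set z | exists2 y, ball x n.+1%:R^-1 y & section N y z].
have mD n : measurable (D n `\` section N x : set (borel X)).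
  apply: (@measurableD _ (borel X)) => //.
  by apply: closed_measurable_borel; exact: closed_closure.
(* A point of every [D n] is a limit of second coordinates of pairs in [N] whose first coordinates
   tend to [x], so it lies in the closed section over [x]. *)
have capD : \bigcap_n (D n `\` section N x) = set0.
  apply/seteqP; split=> // z zD; have [_ Nxz] := zD 0%N I.
  apply: Nxz; apply: N_closed => B [[P Q] /= [Px Qz] PQB].
  have /nbhs_ballP[r /= r0 rP] := Px.
  have [n nr] : exists n : nat, n.+1%:R^-1 < r.
    by have [n] := ltr_add_invr r0; rewrite add0r; exists n.
  have [/(_ _ Qz)[z' [[y xy Nyz'] Qz']] _] := zD n I.
  exists (y, z'); split=> //; apply: PQB; split=> //=.
  by apply: rP; apply: le_ball xy; exact: ltW.
have : (lam \o (fun n => D n `\` section N x : set (borel X))) @ \oo -->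
    lam (\bigcap_n (D n `\` section N x : set (borel X))).
  apply: nonincreasing_cvg_mu => //.
  - by rewrite ltey_eq fin_num_measure.
  - by rewrite capD.
  move=> n m nm; apply/subsetPset => z [Dz Nz]; split=> //.
  apply: closure_subset Dz => t [y xy Ny]; exists y => //.
  by apply: le_ball xy; rewrite lef_pV2 ?posrE// ler_nat.
rewrite capD measure0 => /(_ _ (open_ereal_lt' _)).
move=> /(_ _ (_ : (0 < e%:E)%E)) []; first by rewrite lte_fin.
move=> n _ /(_ n (leqnn n)) /= Dn; apply/nbhs_ballP.
exists n.+1%:R^-1 => /=; first by rewrite invr_gt0.
move=> y xy; apply: le_lt_trans Dn; apply: le_measure; rewrite ?inE//.
by move=> z [Ny Nx]; split=> //; apply: subset_closure; exists y.
Qed.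

(** The orbit of [x] comes near [y], where upper semicontinuity applies, and sections along an orbit
    have equal measure. *)
Lemma section_le x y : Xt act x -> (mu (section N x) <= mu (section N y))%E.
Proof.
move=> xt; apply/lee_addgt0Pr => e e0.
have [g gP] := orbit_near xt (section_usc y e0).
have <- : mu (section N (act g x)) = mu (section N x).
  by rewrite section_act; exact: lam_act.
apply: le_trans (_ : mu (section N y) + mu (section N (act g x) `\` section N y) <= _)%E; last first.
  by apply: leeD => //; exact: ltW.
apply: le_trans (measureU2 _ (mN y) (mND _ y)).
apply: le_measure; rewrite ?inE//; first exact: (@measurableU _ (borel X)).
by move=> z Nz; have [?|?] := pselect (section N y z); [left|right].
Qed.

(** [section_usc] controls only one half of the symmetric difference. At points with dense orbit the
    sections have equal measure, so both halves have the same measure. *)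
Lemma dN_near x (e : R) : Xt act x -> 0 < e ->
  \forall y \near x, Xt act y -> (dN lam N x y < e%:E)%E.
Proof.
move=> xt e0; have e20 : 0 < e / 2 by rewrite divr_gt0.
apply: filterS (section_usc x e20) => y xy yt.
have Nxy : mu (section N x) = mu (section N y).
  by apply/eqP; rewrite eq_le !section_le.
have Dxy : mu (section N x `\` section N y) = mu (section N y `\` section N x).
  rewrite /mu !measureD//; last 2 first.
  - by rewrite ltey_eq fin_num_measure.
  - by rewrite ltey_eq fin_num_measure.
  by rewrite setIC; congr (_ - _)%E.
apply: le_lt_trans (measureU2 _ (mND x y) (mND y x)) _.
by rewrite [e]splitr EFinD; apply: lteD => //; rewrite -Dxy in xy.
Qed.

Variable X0 : set X.
Hypothesis X0_inv : Ginvariant act X0.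
Hypothesis X0t : X0 `<=` Xt act.
Hypothesis lam_supp : forall U : set X, open U -> U !=set0 ->
  (0 < lam (U : set (borel X)))%E.
Hypothesis mX0 : measurable (X0 : set (borel X)).
Hypothesis lamX0 : lam (X0 : set (borel X)) = 1%E.

(** Translates of a small neighbourhood of [x0] share one positive measure, so by packing finitely
    many of them meet all others. A common point is within [e / 2] of both centres. *)
Lemma dN_totally_bounded x0 (e : R) : X0 x0 -> 0 < e ->
  exists s : seq G, forall g,
    exists2 h, h \in s & fine (dN lam N (act h x0) (act g x0)) < e.
Proof.
move=> X0x0 e0; have e20 : 0 < e / 2 by rewrite divr_gt0.
have := dN_near (X0t X0x0) e20; rewrite /prop_near1 nbhsE => -[V [Vo Vx0] VP].
(* The translate by [g] of [V], cut down to [X0] because [dN_near] bounds distances only to points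
   with dense orbit; as [X0] has full measure, nothing is lost. *)
pose A g : set (borel X) := act g^-1%g @^-1` V `&` X0.
have X0E g : act g @^-1` X0 = X0.
  by apply/seteqP; split=> y; rewrite /preimage /= (Ginvariant_act actP _ _ X0_inv).
have mA g : measurable (A g).
  apply: (@measurableI _ (borel X)) => //; apply: open_measurable_borel.
  by apply: open_comp => // y _; case: actP.
have mVX0 : measurable (V `&` X0 : set (borel X)).
  by apply: (@measurableI _ (borel X)) => //; exact: open_measurable_borel.
have lamA g : lam (A g) = (fine (mu (V `&` X0)))%:E.
  by rewrite fineK ?fin_num_measure// -[RHS](lam_act g^-1%g)// preimage_setI X0E.
have lamV : mu (V `&` X0) = mu V.
  have mV := open_measurable_borel Vo.
  rewrite /mu [RHS](measureDI _ mV mX0) [X in (X + _)%E](_ : _ = 0%E) ?add0e//.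
  apply: (@subset_measure0 _ _ _ lam _ (~` X0)).
  - exact: (@measurableD _ (borel X)).
  - exact: (@measurableC _ (borel X)).
  - by move=> y [].
  - by apply: etrans (probability_setC lam mX0) _; rewrite lamX0 subee.
have c0 : 0 < fine (mu (V `&` X0)).
  rewrite -lte_fin fineK ?fin_num_measure//.
  by rewrite lamV; apply: lam_supp => //; exists x0.
have [s sP] := measure_packing c0 mA lamA.
exists s => g; have [h hs [y [[Vh X0y] [Vg _]]]] := sP g; exists h => //.
have half k : V (act k^-1%g y) -> (dN lam N (act k x0) y < (e / 2)%:E)%E.
  move=> /VP Vk; rewrite -[y](actVK actP k) dN_act; apply: Vk.
  by apply: X0t; move: X0y; rewrite -{1}(X0E k^-1%g).
rewrite -lte_fin fineK ?dN_fin_num//.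
apply: le_lt_trans (dN_triangle _ y _) _.
by rewrite [e]splitr EFinD; apply: lteD; [|rewrite dN_sym]; exact: half.
Qed.

(** The set [A] is kept apart from [X0], which supplies the base orbit, so that both [X0] and
    [Xt act] can be taken for [A]. *)
Lemma Seq0_dN (A : set X) x0 x y : X0 x0 -> Ginvariant act A ->
  A `<=` Xt act -> Seq0 R act A (x, y) -> dN lam N x y = 0%E.
Proof.
move=> X0x0 AG At [[/= Ax Ay] xy].
have rho_triangle a b c :
    fine (dN lam N a c) <= fine (dN lam N a b) + fine (dN lam N b c).
  by rewrite -lee_fin EFinD !fineK ?dN_fin_num//; exact: dN_triangle.
have := @isometric_factor R G X act (fun a b => fine (dN lam N a b)) x0 actP.
case=> [a|a b|//|g a b|e e0|Y [actY [pi [Ymin pi_ball pi_inj piG]]]].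
- by rewrite dN_refl.
- by rewrite dN_sym.
- by rewrite dN_act.
- exact: dN_totally_bounded.
(* The dense orbit of [x0] enters each neighbourhood of [a], and [dN] is continuous at [a] along
   points with dense orbit. *)
have AD a : A a -> forall e, 0 < e -> exists g, fine (dN lam N a (act g x0)) < e.
  move=> /At at_ e e0; have [g gP] := orbit_near (X0t X0x0) (dN_near at_ e0).
  exists g; rewrite -lte_fin fineK ?dN_fin_num//; apply: gP.
  by apply/(Ginvariant_act actP _ _ (Xt_Ginvariant actP)); exact: X0t.
rewrite -(fineK (dN_fin_num x y)); congr (_%:E).
apply: pi_inj; [exact: AD|exact: AD|].
apply: (xy Y actY pi Ymin) => [|g a Aa]; last by apply: piG; exact: AD.
apply/subspace_continuousP => a Aa; apply/cvg_ballP => e e0.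
rewrite near_withinE; apply: filterS (dN_near (At _ Aa) e0) => b ab Ab.
apply: pi_ball; [exact: AD|exact: AD|].
by rewrite -lte_fin fineK ?dN_fin_num//; exact/ab/At.
Qed.

End SectionMetric.

(** * Closing the cycle of inclusions *)

Theorem mainTheorem9 (R : realType) (G : groupType) (X : pseudoPMetricType R)
  (act : G -> X -> X) (X0 : set X) (lam : probability (borel X) R) :
  hausdorff_space X -> compact [set: X] ->
  is_action act -> topologically_transitive act ->
  closure X0 = [set: X] -> Ginvariant act X0 -> X0 `<=` Xt act ->
  (forall g (A : set (borel X)), measurable A ->
     lam (act g @^-1` A : set (borel X)) = lam A) ->
  (forall U : set X, open U -> U !=set0 -> (0 < lam (U : set (borel X)))%E) ->
  measurable (X0 : set (borel X)) -> lam (X0 : set (borel X)) = 1%E ->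
  [/\ Q0 act X0 = Sstar0 act X0,
      Sstar0 act X0 = Seq0 R act X0,
      Seq0 R act X0 = bigK act lam X0,
      bigK act lam X0 = bigK act lam (Xt act) `&` (X0 `*` X0)
    & Seq0 R act X0 = Seq0 R act (Xt act) `&` (X0 `*` X0)].
Proof.
move=> _ _ actP _ X0d X0G X0t lam_act lam_supp mX0 lamX0.
have [x0 X0x0] : X0 !=set0.
  have : closure X0 point by rewrite X0d.
  by move=> /(_ _ filterT)[x [X0x _]]; exists x.
have QS : Q0 act X0 `<=` Sstar0 act X0.
  by move=> p Qp; split=> [|E _ _ _]; [case: Qp|exact].
have SE : Sstar0 act X0 `<=` Seq0 R act X0 by exact: Sstar0_sub_Seq0.
have EK A : Ginvariant act A -> A `<=` Xt act ->
    Seq0 R act A `<=` bigK act lam A.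
  move=> AG At [x y] xy N Nc NG; split; first by case: xy.
  exact: (Seq0_dN actP lam_act Nc NG X0G X0t lam_supp mX0 lamX0 X0x0 AG At xy).
have KQ : bigK act lam X0 `<=` Q0 act X0 by exact: bigK_sub_Q0.
have KtK : bigK act lam (Xt act) `&` (X0 `*` X0) `<=` bigK act lam X0.
  by move=> p [pK X0p] N Nc NG; split=> //; case: (pK N Nc NG).
have X02t : X0 `*` X0 `<=` Xt act `*` Xt act.
  by move=> p [X0p1 X0p2]; split; exact: X0t.
have EK0 := EK X0 X0G X0t.
split; apply/seteqP; split=> //.
- by move=> p /SE/EK0/KQ.
- by move=> p /EK0/KQ/QS.
- by move=> p /KQ/QS/SE.
- move=> p pK; have [X0p _] := pK _ closed0 (fun g => image_set0 _).
  by split=> // N Nc NG; have [_ dN0] := pK N Nc NG; split=> //; exact: X02t.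
(* A factor map of [Xt act] restricts to one of [X0]. *)
- move=> p [X0p pE]; split=> //; split; first exact: X02t.
  move=> Y actY pi Ymin pic piG; apply: (pE Y actY pi Ymin) => [|g x /X0t].
    exact: continuous_subspaceW pic.
  exact: piG.
(* A factor map of [X0] is not extended to [Xt act]; the inclusion goes through [bigK] on [Xt act],
   then on [X0], and around the cycle. *)
- move=> p [/(EK _ (Xt_Ginvariant actP) (fun _ => id)) pK X0p].
  by apply/SE/QS/KQ/KtK.
Qed.
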